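(* Let $v\ge0$ and let $K_v$ be the modified Bessel function of the second kind. Define $\Lambda(x)=x+\dfrac{xK_v'(x)}{K_v(x)}$ for $x>0$. (i) If $v\in(1/2,\infty)$, then $\Lambda$ is strictly increasing from $(0,\infty)$ onto $(-v,-1/2)$. (ii) If $v\in[0,1/2)$, then $\Lambda$ is strictly decreasing from $(0,\infty)$ onto $(-1/2,-v)$. (iii) If $v\ne1/2$, then the double inequality $$-x-\max\left(v,\tfrac12\right)<\frac{xK_v'(x)}{K_v(x)}<-x-\min\left(v,\tfrac12\right)$$ holds for all $x>0$, and the constants $\min(v,1/2)$ and $\max(v,1/2)$ are best possible.
   Context: The modified Bessel function of the second kind of order $v$ is given for $x>0$ by $K_v(x)=\int_0^\infty e^{-x\cosh t}\cosh(vt)\,dt$ (equivalently $K_v(x)=\frac{\pi}{2}\frac{I_{-v}(x)-I_v(x)}{\sin(v\pi)}$, with the limiting value when $v$ is an integer, where $I_v(x)=\sum_{n\ge0}\frac{(x/2)^{2n+v}}{n!\,\Gamma(v+n+1)}$). The prime denotes differentiation in $x$. *)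

(* Defs.v *)
From Stdlib Require Import Reals.
From Coquelicot Require Import Coquelicot.
Open Scope R_scope.

(* [at_point 0]: the integrand is continuous at 0, so the integral is improper
   only at +oo. *)
Definition besselK (v x : R) : R :=
  RInt_gen (fun t => exp (- x * cosh t) * cosh (v * t))
    (at_point 0) (Rbar_locally p_infty).

Definition Lambda (v x : R) : R :=
  x + x * Derive (besselK v) x / besselK v x.

Definition strictly_increasing_pos (f : R -> R) : Prop :=
  forall x y, 0 < x -> x < y -> f x < f y.

Definition strictly_decreasing_pos (f : R -> R) : Prop :=
  forall x y, 0 < x -> x < y -> f y < f x.

Definition pos_onto (f : R -> R) (a b : R) : Prop :=
  (forall x, 0 < x -> a < f x < b) /\
  (forall y, a < y < b -> exists x, 0 < x /\ f x = y).

(* Main.v *)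
Require Import Defs.
From Stdlib Require Import Reals Lra.
From Coquelicot Require Import Coquelicot.
Open Scope R_scope.

(** Differentiating under the integral and integrating by parts gives the Bessel
    equation x^2 K'' + x K' = (x^2 + v^2) K, hence the Riccati equation
    x L' = v^2 - L^2 + x (1 + 2 L) for L = Lambda v.  Moreover - (1 + v) < L < 0.
    The function u = s (1 + 2 L), with s the sign of 1/2 - v, satisfies
    x u' = - k + u - (s / 2) u^2 + 2 x u with k > 0.  If u <= 0 somewhere, then u
    is negative afterwards and tends to -oo; if u' >= 0 somewhere, then
    u' > 0 afterwards and u tends to +oo.  Since u is bounded, u > 0 and u' < 0
    everywhere.  Boundedness also forces u -> 0 at +oo and, since x u' must not
    stay away from 0 near 0, L^2 -> v^2 at 0. *)

(** * Integrals of exp (- x cosh t) c(t) over the half-line *)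

(** The substitution s = cosh t turns this into a Laplace transform. [besselK v] is convertible to
    the case of the weight [cosh (v * t)], and differentiating in [x] only changes the weight. *)
Definition cosh_laplace (c : R -> R) (x : R) : R :=
  RInt_gen (fun t => exp (- x * cosh t) * c t)
    (at_point 0) (Rbar_locally p_infty).

(** A class of weights that contains [cosh] and [sinh] and is closed under sums and products; the
    factor exp (- x cosh t) beats all of them. *)
Definition exp_growth (c : R -> R) : Prop :=
  (forall t, continuous c t) /\
  exists C a, forall t, 0 <= t -> Rabs (c t) <= C * exp (a * t).

(** * Elementary facts on exp, cosh and sinh *)

Lemma exp_le_compat a b : a <= b -> exp a <= exp b.
Proof.
intros [H | ->]; [left; now apply exp_increasing | apply Rle_refl].
Qed.

Lemma is_derive_cosh t : is_derive cosh t (sinh t).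
Proof. apply is_derive_Reals, derivable_pt_lim_cosh. Qed.

Lemma is_derive_sinh t : is_derive sinh t (cosh t).
Proof. apply is_derive_Reals, derivable_pt_lim_sinh. Qed.

Lemma is_derive_cosh_scal v t :
  is_derive (fun s => cosh (v * s)) t (v * sinh (v * t)).
Proof.
apply (is_derive_comp cosh (fun s => v * s) t (sinh (v * t)) v).
- apply is_derive_cosh.
- auto_derive; [easy | ring].
Qed.

Lemma is_derive_sinh_scal v t :
  is_derive (fun s => sinh (v * s)) t (v * cosh (v * t)).
Proof.
apply (is_derive_comp sinh (fun s => v * s) t (cosh (v * t)) v).
- apply is_derive_sinh.
- auto_derive; [easy | ring].
Qed.

Lemma is_derive_continuous (f : R -> R) t l : is_derive f t l -> continuous f t.
Proof. intros H; apply (ex_derive_continuous f); now exists l. Qed.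

Lemma cosh_ge_1 t : 1 <= cosh t.
Proof.
unfold cosh.
pose proof (exp_ineq1_le t); pose proof (exp_ineq1_le (- t)); lra.
Qed.

Lemma cosh_gt_1 t : 0 < t -> 1 < cosh t.
Proof.
intros Ht; unfold cosh.
pose proof (exp_ineq1 t ltac:(lra)); pose proof (exp_ineq1_le (- t)); lra.
Qed.

(** Follows from exp t = exp (t / 2) ^ 2 and exp (t / 2) >= 1 + t / 2. Quadratic growth is enough to
    dominate any exponent linear in t. *)
Lemma cosh_ge_sqr t : 0 <= t -> t ^ 2 / 8 <= cosh t.
Proof.
intros Ht; unfold cosh.
assert (H : exp t = exp (t / 2) * exp (t / 2)) by (rewrite <- exp_plus; f_equal; lra).
pose proof (exp_pos (- t)); pose proof (exp_ineq1_le (t / 2)).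
nra.
Qed.

Lemma cosh2_sinh2 t : cosh t * cosh t - sinh t * sinh t = 1.
Proof.
unfold cosh, sinh.
assert (H : exp t * exp (- t) = 1) by (rewrite <- exp_plus, Rplus_opp_r; apply exp_0).
nra.
Qed.

Lemma Rabs_cosh_sinh_le v t :
  0 <= t ->
  Rabs (cosh (v * t)) <= 1 * exp (Rabs v * t) /\
  Rabs (sinh (v * t)) <= 1 * exp (Rabs v * t).
Proof.
intros Ht.
assert (H1 : exp (v * t) <= exp (Rabs v * t)).
{ apply exp_le_compat.
  apply Rmult_le_compat_r; [easy | apply Rle_abs]. }
assert (H2 : exp (- (v * t)) <= exp (Rabs v * t)).
{ apply exp_le_compat. rewrite <- Ropp_mult_distr_l_reverse, <- (Rabs_Ropp v).
  apply Rmult_le_compat_r; [easy | apply Rle_abs]. }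
pose proof (exp_pos (v * t)); pose proof (exp_pos (- (v * t))).
unfold cosh, sinh; split; apply Rabs_le; lra.
Qed.

(** * Weights of exponential growth *)

Lemma exp_growth_cosh v : exp_growth (fun t => cosh (v * t)).
Proof.
split.
- intros t; eapply is_derive_continuous, is_derive_cosh_scal.
- exists 1, (Rabs v); intros t Ht; now apply Rabs_cosh_sinh_le.
Qed.

Lemma exp_growth_sinh v : exp_growth (fun t => sinh (v * t)).
Proof.
split.
- intros t; eapply is_derive_continuous, is_derive_sinh_scal.
- exists 1, (Rabs v); intros t Ht; now apply Rabs_cosh_sinh_le.
Qed.

Lemma exp_growth_ext c d : (forall t, c t = d t) -> exp_growth c -> exp_growth d.
Proof.
intros H [Hc [C [a Hb]]]; split.
- intros t; now apply (continuous_ext c).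
- exists C, a; intros t Ht; rewrite <- H; auto.
Qed.

Lemma exp_growth_cosh1 : exp_growth cosh.
Proof.
apply (exp_growth_ext (fun t => cosh (1 * t))); [| apply exp_growth_cosh].
intros t; now rewrite Rmult_1_l.
Qed.

Lemma exp_growth_sinh1 : exp_growth sinh.
Proof.
apply (exp_growth_ext (fun t => sinh (1 * t))); [| apply exp_growth_sinh].
intros t; now rewrite Rmult_1_l.
Qed.

Lemma exp_growth_mult c d :
  exp_growth c -> exp_growth d -> exp_growth (fun t => c t * d t).
Proof.
intros [Hc [C [a Ha]]] [Hd [D [b Hb]]]; split.
- intros t; now apply (continuous_mult c d).
- exists (C * D), (a + b); intros t Ht.
  rewrite Rabs_mult.
  replace (C * D * exp ((a + b) * t)) with (C * exp (a * t) * (D * exp (b * t)))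
    by (rewrite Rmult_plus_distr_r, exp_plus; ring).
  apply Rmult_le_compat; auto using Rabs_pos.
Qed.

Lemma exp_growth_abs c : exp_growth c -> exp_growth (fun t => Rabs (c t)).
Proof.
intros [Hc [C [a Ha]]]; split.
- intros t; apply (continuous_comp c Rabs); [easy | apply continuous_Rabs].
- exists C, a; intros t Ht; rewrite Rabs_Rabsolu; auto.
Qed.

Lemma exp_growth_of_bounded c C :
  (forall t, continuous c t) -> (forall t, Rabs (c t) <= C) -> exp_growth c.
Proof.
intros H1 H2; split; [easy | exists C, 0; intros t _].
now rewrite Rmult_0_l, exp_0, Rmult_1_r.
Qed.

Lemma exp_growth_const a : exp_growth (fun _ => a).
Proof.
apply (exp_growth_of_bounded _ (Rabs a)); intros t.
- apply continuous_const.
- lra.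
Qed.

Lemma exp_growth_plus c d :
  exp_growth c -> exp_growth d -> exp_growth (fun t => c t + d t).
Proof.
intros [Hc [C [a Ha]]] [Hd [D [b Hb]]]; split.
- intros t; now apply (continuous_plus c d).
- exists (C + D), (Rmax a b); intros t Ht.
  pose proof (Rabs_triang (c t) (d t)).
  specialize (Ha t Ht); specialize (Hb t Ht).
  pose proof (Rabs_pos (c t)); pose proof (Rabs_pos (d t)).
  assert (exp (a * t) <= exp (Rmax a b * t))
    by (apply exp_le_compat, Rmult_le_compat_r; [easy | apply Rmax_l]).
  assert (exp (b * t) <= exp (Rmax a b * t))
    by (apply exp_le_compat, Rmult_le_compat_r; [easy | apply Rmax_r]).
  pose proof (exp_pos (a * t)); pose proof (exp_pos (b * t)).
  (* [C] and [D] dominate absolute values, hence are nonnegative; this permits raising both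
     exponents to the maximum. *)
  assert (0 <= C) by nra.
  assert (0 <= D) by nra.
  nra.
Qed.

Lemma exp_growth_scal k c : exp_growth c -> exp_growth (fun t => k * c t).
Proof. intros H; apply (exp_growth_mult (fun _ => k)); [apply exp_growth_const | easy]. Qed.

(** * Convergence, linearity and positivity of the integrals *)

Lemma cosh_laplace_integrand_le c x :
  exp_growth c -> 0 < x ->
  exists D, 0 <= D /\
    forall t, 0 <= t -> Rabs (exp (- x * cosh t) * c t) <= D * exp (- t).
Proof.
intros [_ [C [a Hc]]] Hx.
assert (HC : 0 <= C).
{ specialize (Hc 0 (Rle_refl 0)). rewrite Rmult_0_r, exp_0 in Hc.
  pose proof (Rabs_pos (c 0)); lra. }
(* The constant comes from completing the square in x t^2 / 8 - (a + 1) t, a lower bound for x cosh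
   t - (a + 1) t. *)
exists (C * exp (2 * (a + 1) ^ 2 / x)); split.
{ apply Rmult_le_pos; [easy | left; apply exp_pos]. }
intros t Ht.
rewrite Rabs_mult, (Rabs_pos_eq (exp _)) by (left; apply exp_pos).
apply Rle_trans with (exp (- x * cosh t) * (C * exp (a * t))).
{ apply Rmult_le_compat_l; [left; apply exp_pos | auto]. }
rewrite <- Rmult_assoc, (Rmult_comm _ C), !Rmult_assoc, <- !exp_plus.
apply Rmult_le_compat_l; [easy | apply exp_le_compat].
pose proof (cosh_ge_sqr t Ht) as Hs.
assert (Hq : 0 <= x / 8 * (t - 4 * (a + 1) / x) ^ 2).
{ apply Rmult_le_pos; [lra | apply pow2_ge_0]. }
replace (x / 8 * (t - 4 * (a + 1) / x) ^ 2)
  with (x * (t ^ 2 / 8) - (a + 1) * t + 2 * (a + 1) ^ 2 / x) in Hq by (field; lra).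
nra.
Qed.

Lemma continuous_cosh_laplace_integrand c x t :
  exp_growth c -> continuous (fun t => exp (- x * cosh t) * c t) t.
Proof.
intros [Hc _].
apply (continuous_mult (fun t => exp (- x * cosh t)) c); [| easy].
apply (ex_derive_continuous (fun t => exp (- x * cosh t))).
auto_derive; easy.
Qed.

Lemma ex_RInt_cosh_laplace c x a b :
  exp_growth c -> ex_RInt (fun t => exp (- x * cosh t) * c t) a b.
Proof.
intros Hc; apply (ex_RInt_continuous (V := R_CompleteNormedModule)).
intros t _; now apply continuous_cosh_laplace_integrand.
Qed.

Lemma is_RInt_gen_of_is_lim (f : R -> R) (a l : R) :
  (forall b, ex_RInt f a b) ->
  is_lim (fun b => RInt f a b) p_infty l ->
  is_RInt_gen f (at_point a) (Rbar_locally p_infty) l.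
Proof.
intros Hf Hl P HP.
apply (Filter_prod _ _ _ (fun s => s = a) (fun b => P (RInt f a b))).
- easy.
- now apply Hl.
- intros s b -> Hb; simpl.
  exists (RInt f a b); split; [| easy].
  now apply (RInt_correct (V := R_CompleteNormedModule)).
Qed.

(** Cauchy's criterion: the integral of [f] over [a, b] is at most D exp (- a), whatever b is. *)
Lemma ex_lim_RInt_exp_dominated (f : R -> R) (D : R) :
  (forall t, continuous f t) ->
  (forall t, 0 <= t -> Rabs (f t) <= D * exp (- t)) ->
  exists l : R, is_lim (fun b => RInt f 0 b) p_infty l.
Proof.
intros Hf HD.
assert (Hex : forall a b, ex_RInt f a b).
{ intros a b; apply (ex_RInt_continuous (V := R_CompleteNormedModule)); auto. }
assert (HD0 : 0 <= D).
{ specialize (HD 0 (Rle_refl 0)). rewrite Ropp_0, exp_0 in HD.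
  pose proof (Rabs_pos (f 0)); lra. }
assert (Hle : forall a b, 0 <= a -> a <= b ->
  Rabs (RInt f 0 b - RInt f 0 a) <= D * exp (- a)).
{ intros a b Ha Hab.
  assert (HC : RInt f 0 a + RInt f a b = RInt f 0 b) by (apply (RInt_Chasles f); auto).
  rewrite <- HC; unfold Rminus; rewrite Rplus_comm, <- Rplus_assoc, Rplus_opp_l, Rplus_0_l.
  apply Rle_trans with (RInt (fun t => D * exp (- t)) a b).
  { apply Rle_trans with (RInt (fun t => Rabs (f t)) a b).
    { now apply abs_RInt_le. }
    apply RInt_le; [easy | | |].
    - apply (ex_RInt_norm f); auto.
    - apply (ex_RInt_continuous (V := R_CompleteNormedModule)).
      intros t _; apply (ex_derive_continuous (fun t => D * exp (- t))).
      auto_derive; easy.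
    - intros t Ht; apply HD; lra. }
  rewrite (is_RInt_unique (fun t => D * exp (- t)) a b
            (minus (- D * exp (- b)) (- D * exp (- a)))).
  { unfold minus, plus, opp; simpl.
    pose proof (exp_pos (- b)); nra. }
  apply (is_RInt_derive (fun t => - D * exp (- t))).
  - intros t _; auto_derive; [easy | ring].
  - intros t _; apply (ex_derive_continuous (fun t => D * exp (- t))).
    auto_derive; easy. }
assert (Hc : exists l, filterlim (fun b => RInt f 0 b) (Rbar_locally p_infty) (locally l)).
{ apply (filterlim_locally_cauchy (U := R_CompleteNormedModule)).
  intros eps.
  (* Since exp (M + 1) >= M + 2 > 2 D / eps, every integral up to a point beyond M + 1 is within eps
     / 2 of the one up to M + 1. *)
  set (M := Rmax 0 (2 * D / eps)).
  assert (HM : D * exp (- (M + 1)) < eps / 2).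
  { pose proof (cond_pos eps) as He.
    assert (2 * D / eps < exp (M + 1)).
    { pose proof (exp_ineq1_le (M + 1)).
      pose proof (Rmax_r 0 (2 * D / eps)); fold M in H0; lra. }
    assert (2 * D < exp (M + 1) * eps).
    { apply (Rmult_lt_compat_r eps) in H; [| easy].
      replace (2 * D / eps * eps) with (2 * D) in H by (field; lra); easy. }
    rewrite exp_Ropp.
    apply (Rmult_lt_reg_r (exp (M + 1))); [apply exp_pos |].
    rewrite Rmult_assoc, Rinv_l by (pose proof (exp_pos (M + 1)); lra).
    lra. }
  assert (HM0 : 0 <= M) by apply Rmax_l.
  exists (fun b => M + 1 < b); split.
  { exists (M + 1); auto. }
  intros a b Ha Hb.
  unfold ball; simpl; unfold AbsRing_ball, abs, minus, plus, opp; simpl.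
  pose proof (Hle (M + 1) a ltac:(lra) ltac:(lra)) as H1.
  pose proof (Hle (M + 1) b ltac:(lra) ltac:(lra)) as H2.
  apply Rabs_le_between in H1; apply Rabs_le_between in H2.
  apply Rabs_lt_between; lra. }
destruct Hc as [l Hl]; now exists l.
Qed.

Lemma cosh_laplace_unique c x l :
  is_RInt_gen (fun t => exp (- x * cosh t) * c t)
    (at_point 0) (Rbar_locally p_infty) l ->
  cosh_laplace c x = l.
Proof.
intros H; unfold cosh_laplace.
exact (is_RInt_gen_unique (V := R_CompleteNormedModule) _ l H).
Qed.

Lemma cosh_laplace_is_lim c x :
  exp_growth c -> 0 < x ->
  is_lim (fun b => RInt (fun t => exp (- x * cosh t) * c t) 0 b) p_infty (cosh_laplace c x).
Proof.
intros Hc Hx.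
destruct (cosh_laplace_integrand_le c x Hc Hx) as [D [_ HD]].
destruct (ex_lim_RInt_exp_dominated (fun t => exp (- x * cosh t) * c t) D) as [l Hl]; auto.
{ intros t; now apply continuous_cosh_laplace_integrand. }
replace (cosh_laplace c x) with l; [easy | symmetry].
apply cosh_laplace_unique.
apply is_RInt_gen_of_is_lim; [| easy].
intros b; now apply ex_RInt_cosh_laplace.
Qed.

Lemma cosh_laplace_correct c x :
  exp_growth c -> 0 < x ->
  is_RInt_gen (fun t => exp (- x * cosh t) * c t)
    (at_point 0) (Rbar_locally p_infty) (cosh_laplace c x).
Proof.
intros Hc Hx; apply is_RInt_gen_of_is_lim.
- intros b; now apply ex_RInt_cosh_laplace.
- now apply cosh_laplace_is_lim.
Qed.

Lemma cosh_laplace_ext c d x :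
  (forall t, c t = d t) -> exp_growth c -> 0 < x -> cosh_laplace c x = cosh_laplace d x.
Proof.
intros H Hc Hx; symmetry; apply cosh_laplace_unique.
apply (is_RInt_gen_ext (fun t => exp (- x * cosh t) * c t)).
- apply filter_forall; intros ab t _; now rewrite H.
- now apply cosh_laplace_correct.
Qed.

Lemma cosh_laplace_plus c d x :
  exp_growth c -> exp_growth d -> 0 < x ->
  cosh_laplace (fun t => c t + d t) x = cosh_laplace c x + cosh_laplace d x.
Proof.
intros Hc Hd Hx.
apply cosh_laplace_unique.
apply (is_RInt_gen_ext (fun t => plus (exp (- x * cosh t) * c t) (exp (- x * cosh t) * d t))).
{ apply filter_forall; intros ab t _; unfold plus; simpl; ring. }
apply (is_RInt_gen_plus (V := R_NormedModule)); now apply cosh_laplace_correct.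
Qed.

Lemma cosh_laplace_scal k c x :
  exp_growth c -> 0 < x -> cosh_laplace (fun t => k * c t) x = k * cosh_laplace c x.
Proof.
intros Hc Hx.
apply cosh_laplace_unique.
apply (is_RInt_gen_ext (fun t => scal k (exp (- x * cosh t) * c t))).
{ apply filter_forall; intros ab t _; unfold scal; simpl; unfold mult; simpl; ring. }
apply (is_RInt_gen_scal (V := R_NormedModule)); now apply cosh_laplace_correct.
Qed.

(** The integral over [0, 1] is already positive and the rest only adds to it. The weight may vanish
    at 0, as cosh t - 1 does in later comparisons. *)
Lemma cosh_laplace_gt_0 c x :
  exp_growth c -> 0 < x -> (forall t, 0 < t -> 0 < c t) -> 0 < cosh_laplace c x.
Proof.
intros Hc Hx Hpos.
set (f := fun t => exp (- x * cosh t) * c t).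
assert (Hf : forall t, 0 < t -> 0 < f t).
{ intros t Ht; apply Rmult_lt_0_compat; [apply exp_pos | auto]. }
assert (H1 : 0 < RInt f 0 1).
{ apply RInt_gt_0; [lra | |].
  - intros t Ht; apply Hf; lra.
  - intros t _; now apply continuous_cosh_laplace_integrand. }
apply Rlt_le_trans with (1 := H1).
apply (is_lim_le_loc (fun _ => RInt f 0 1) (fun b => RInt f 0 b) p_infty
         (Finite (RInt f 0 1)) (Finite (cosh_laplace c x))).
- exists 1; intros b Hb.
  rewrite <- (RInt_Chasles f 0 1 b) by now apply ex_RInt_cosh_laplace.
  assert (0 <= RInt f 1 b).
  { apply RInt_ge_0; [lra | now apply ex_RInt_cosh_laplace |].
    intros t Ht; left; apply Hf; lra. }
  unfold plus; simpl; lra.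
- apply is_lim_const.
- now apply cosh_laplace_is_lim.
Qed.

Lemma cosh_laplace_lt c d x :
  exp_growth c -> exp_growth d -> 0 < x ->
  (forall t, 0 < t -> c t < d t) -> cosh_laplace c x < cosh_laplace d x.
Proof.
intros Hc Hd Hx H.
assert (H0 : 0 < cosh_laplace (fun t => d t + (-1) * c t) x).
{ apply cosh_laplace_gt_0; auto using exp_growth_plus, exp_growth_scal.
  intros t Ht; specialize (H t Ht); lra. }
rewrite cosh_laplace_plus, cosh_laplace_scal in H0; auto using exp_growth_scal; lra.
Qed.

(** * Differentiation under the integral sign *)

Lemma exp_taylor1_le y : Rabs (exp y - 1 - y) <= y ^ 2 * exp (Rabs y).
Proof.
pose proof (exp_ineq1_le y) as H1.
pose proof (exp_ineq1_le (- y)) as H2.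
assert (H : exp y * exp (- y) = 1) by (rewrite <- exp_plus, Rplus_opp_r; apply exp_0).
pose proof (exp_pos y) as H3; pose proof (exp_pos (- y)) as H4.
(* This is 1 - y <= exp (- y) multiplied by exp y; bounding exp y - 1 by the same inequality gives
   the second factor y. *)
assert (H5 : exp y - 1 - y <= y * (exp y - 1)) by nra.
rewrite Rabs_pos_eq by lra.
apply Rle_trans with (1 := H5).
destruct (Rle_dec 0 y) as [Hy | Hy].
- rewrite (Rabs_pos_eq y) by easy.
  assert (exp y - 1 <= y * exp y) by nra. nra.
- rewrite (Rabs_left y) by lra.
  assert (1 <= exp (- y)) by lra.
  assert (0 <= 1 - exp y <= - y) by (split; nra).
  nra.
Qed.

Lemma Rabs_is_RInt_gen_le_cosh_laplace (f : R -> R) l d x :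
  exp_growth d -> 0 < x ->
  is_RInt_gen f (at_point 0) (Rbar_locally p_infty) l ->
  (forall t, 0 <= t -> Rabs (f t) <= exp (- x * cosh t) * d t) ->
  Rabs l <= cosh_laplace d x.
Proof.
intros Hd Hx Hl H.
refine (RInt_gen_norm (V := R_CompleteNormedModule) f
  (fun t => exp (- x * cosh t) * d t) l (cosh_laplace d x) _ _ Hl _).
- apply (Filter_prod _ _ _ (fun s => s = 0) (fun b => 0 < b)); [easy | now exists 0 |].
  intros a b -> Hb; simpl; lra.
- apply (Filter_prod _ _ _ (fun s => s = 0) (fun b => 0 < b)); [easy | now exists 0 |].
  intros a b -> Hb t Ht; simpl in *; apply H; lra.
- now apply cosh_laplace_correct.
Qed.

Lemma is_derive_of_sqr_error (f : R -> R) (x l M d : R) :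
  0 < d ->
  (forall h, Rabs h <= d -> Rabs (f (x + h) - f x - h * l) <= h ^ 2 * M) ->
  is_derive f x l.
Proof.
intros Hd H.
assert (HM : 0 <= M).
{ specialize (H d). rewrite (Rabs_pos_eq d) in H by lra.
  pose proof (Rabs_pos (f (x + d) - f x - d * l)).
  assert (0 < d ^ 2) by (apply pow_lt; lra). nra. }
apply is_derive_Reals; intros eps Heps.
assert (Hp : 0 < Rmin d (eps / (M + 1))).
{ apply Rmin_pos; [easy |]. apply Rdiv_lt_0_compat; lra. }
exists (mkposreal _ Hp); intros h Hh0 Hh; simpl in Hh.
pose proof (Rmin_l d (eps / (M + 1))); pose proof (Rmin_r d (eps / (M + 1))).
specialize (H h ltac:(lra)).
assert (Ha : 0 < Rabs h) by now apply Rabs_pos_lt.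
replace ((f (x + h) - f x) / h - l) with ((f (x + h) - f x - h * l) / h) by (field; easy).
rewrite Rabs_div by easy.
apply (Rmult_lt_reg_r (Rabs h)); [easy |].
unfold Rdiv; rewrite Rmult_assoc, Rinv_l, Rmult_1_r by lra.
apply Rle_lt_trans with (1 := H).
rewrite <- pow2_abs.
assert (Rabs h * (M + 1) < eps).
{ apply Rlt_le_trans with (eps / (M + 1) * (M + 1)).
  - apply Rmult_lt_compat_r; lra.
  - right; field; lra. }
nra.
Qed.

(** The Taylor remainder of exp (- h cosh t) is at most h^2 cosh^2 t exp (|h| cosh t). For |h| <= x
    / 2 the last factor costs only half of exp (- x cosh t), so the error is h^2 times a convergent
    integral at x / 2. *)
Lemma is_derive_cosh_laplace c x :
  exp_growth c -> 0 < x ->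
  is_derive (cosh_laplace c) x (- cosh_laplace (fun t => cosh t * c t) x).
Proof.
intros Hc Hx.
pose proof (exp_growth_mult _ _ exp_growth_cosh1 Hc) as Hc1.
set (d := fun t => cosh t * (cosh t * Rabs (c t))).
assert (Hd : exp_growth d) by
  (unfold d; apply (exp_growth_mult cosh), (exp_growth_mult cosh);
   auto using exp_growth_cosh1, exp_growth_abs).
apply (is_derive_of_sqr_error _ _ _ (cosh_laplace d (x / 2)) (x / 2)); [lra |].
intros h Hh.
assert (Hxh : 0 < x + h) by (apply Rabs_le_between in Hh; lra).
rewrite <- (cosh_laplace_scal (h ^ 2)) by (easy || lra).
(* The whole error is written as one improper integral, so that a pointwise bound on its integrand
   suffices. *)
pose proof (is_RInt_gen_plus (V := R_NormedModule) _ _ _ _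
  (is_RInt_gen_minus (V := R_NormedModule) _ _ _ _
    (cosh_laplace_correct c (x + h) Hc Hxh) (cosh_laplace_correct c x Hc Hx))
  (is_RInt_gen_scal (V := R_NormedModule) _ h _
    (cosh_laplace_correct _ x Hc1 Hx))) as HI.
replace (cosh_laplace c (x + h) - cosh_laplace c x - h * - cosh_laplace (fun t => cosh t * c t) x)
  with (plus (minus (cosh_laplace c (x + h)) (cosh_laplace c x))
    (scal h (cosh_laplace (fun t => cosh t * c t) x)))
  by (unfold minus, plus, scal, opp; simpl; unfold mult; simpl; ring).
apply (Rabs_is_RInt_gen_le_cosh_laplace _ _ _ (x / 2) (exp_growth_scal (h ^ 2) d Hd) ltac:(lra) HI).
intros t Ht.
unfold plus, minus, scal, opp, plus; simpl; unfold mult; simpl.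
pose proof (cosh_ge_1 t) as Hch.
replace (exp (- (x + h) * cosh t)) with (exp (- x * cosh t) * exp (- h * cosh t))
  by (rewrite <- exp_plus; f_equal; ring).
replace (exp (- (x / 2) * cosh t)) with (exp (- x * cosh t) * exp (x / 2 * cosh t))
  by (rewrite <- exp_plus; f_equal; field).
replace (_ + _) with
  (exp (- x * cosh t) * (exp (- h * cosh t) - 1 - (- h * cosh t)) * c t) by ring.
rewrite !Rabs_mult, (Rabs_pos_eq (exp _)) by (left; apply exp_pos).
unfold d.
pose proof (exp_taylor1_le (- h * cosh t)) as H1.
assert (H2 : exp (Rabs (- h * cosh t)) <= exp (x / 2 * cosh t)).
{ apply exp_le_compat. rewrite Rabs_mult, Rabs_Ropp, (Rabs_pos_eq (cosh t)) by lra.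
  apply Rmult_le_compat_r; lra. }
assert (H3 : Rabs (exp (- h * cosh t) - 1 - - h * cosh t)
  <= (- h * cosh t) ^ 2 * exp (x / 2 * cosh t)).
{ apply Rle_trans with (1 := H1), Rmult_le_compat_l; [apply pow2_ge_0 | easy]. }
apply Rle_trans with
  (exp (- x * cosh t) * ((- h * cosh t) ^ 2 * exp (x / 2 * cosh t)) * Rabs (c t)).
- apply Rmult_le_compat_r; [apply Rabs_pos |].
  apply Rmult_le_compat_l; [left; apply exp_pos | easy].
- right; ring.
Qed.

(** * Integration by parts on the half-line *)

Lemma is_lim_exp_dominated (f : R -> R) (D : R) :
  (forall t, 0 <= t -> Rabs (f t) <= D * exp (- t)) -> is_lim f p_infty 0.
Proof.
intros H.
assert (He : forall k, is_lim (fun t => k * exp (- t)) p_infty 0).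
{ intros k; replace (Finite 0) with (Rbar_mult k 0) by (simpl; f_equal; ring).
  apply is_lim_scal_l.
  apply (is_lim_comp exp (fun t => - t) p_infty 0 m_infty).
  - apply is_lim_exp_m.
  - apply (is_lim_opp (fun t => t) p_infty p_infty), is_lim_id.
  - now exists 0. }
apply (is_lim_le_le_loc (fun t => - D * exp (- t)) (fun t => D * exp (- t))); auto.
exists 0; intros t Ht.
specialize (H t ltac:(lra)); apply Rabs_le_between in H; lra.
Qed.

(** The derivative of exp (- x cosh t) c(t) has weight c' - x sinh c. Its integral is the boundary
    term at 0 alone, since the one at infinity vanishes. *)
Lemma cosh_laplace_by_parts c c' x :
  exp_growth c -> exp_growth c' -> (forall t, is_derive c t (c' t)) -> 0 < x ->
  x * cosh_laplace (fun t => sinh t * c t) x = exp (- x) * c 0 + cosh_laplace c' x.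
Proof.
intros Hc Hc' Hd Hx.
assert (Hs : exp_growth (fun t => sinh t * c t))
  by (apply exp_growth_mult; auto using exp_growth_sinh1).
set (g := fun t => c' t + (- x) * (sinh t * c t)).
assert (Hg : exp_growth g) by (apply exp_growth_plus; auto using exp_growth_scal).
assert (H : cosh_laplace g x = 0 - exp (- x) * c 0).
{ assert (H1 : is_lim (fun b => RInt (fun t => exp (- x * cosh t) * g t) 0 b) p_infty
                 (0 - exp (- x) * c 0)).
  { apply (is_lim_ext (fun b => exp (- x * cosh b) * c b - exp (- x) * c 0)).
    { intros b; symmetry.
      rewrite (is_RInt_unique _ _ _ (minus (exp (- x * cosh b) * c b) (exp (- x * cosh 0) * c 0))).
      { rewrite cosh_0, Rmult_1_r; unfold minus, plus, opp; simpl; ring. }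
      apply (is_RInt_derive (fun t => exp (- x * cosh t) * c t)).
      - intros t _; unfold g.
        evar_last.
        { apply (is_derive_mult (fun t => exp (- x * cosh t)) c t
            (- x * sinh t * exp (- x * cosh t)) (c' t)).
          - auto_derive; [easy | ring].
          - apply Hd.
          - intros; apply Rmult_comm. }
        unfold plus, mult; simpl; unfold mult; simpl; ring.
      - intros t _; now apply continuous_cosh_laplace_integrand. }
    apply (is_lim_minus' _ (fun _ => exp (- x) * c 0)); [| apply is_lim_const].
    destruct (cosh_laplace_integrand_le c x Hc Hx) as [D [_ HD]].
    now apply (is_lim_exp_dominated _ D). }
  apply is_lim_unique in H1.
  pose proof (is_lim_unique _ _ _ (cosh_laplace_is_lim g x Hg Hx)) as H2.
  rewrite H1 in H2; now injection H2. }
unfold g in H.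
rewrite cosh_laplace_plus, cosh_laplace_scal in H; auto using exp_growth_scal; lra.
Qed.

(** * Bounded solutions of a Riccati equation *)

Lemma is_derive_pos_locally (f : R -> R) x l :
  is_derive f x l -> 0 < l ->
  exists d, 0 < d /\
    (forall y, x < y < x + d -> f x < f y) /\
    (forall y, x - d < y < x -> f y < f x).
Proof.
intros Hf Hl; apply is_derive_Reals in Hf.
(* With tolerance [l] itself, the difference quotient stays positive. *)
destruct (Hf l Hl) as [d Hd]; exists d; split; [apply cond_pos |].
assert (Hq : forall y, y - x <> 0 -> Rabs (y - x) < d -> 0 < (f y - f x) / (y - x)).
{ intros y H0 H1; specialize (Hd (y - x) H0 H1).
  replace (x + (y - x)) with y in Hd by ring.
  apply Rabs_lt_between in Hd; lra. }
split; intros y Hy.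
- specialize (Hq y ltac:(lra)); rewrite Rabs_pos_eq in Hq by lra.
  specialize (Hq ltac:(lra)).
  apply (Rmult_lt_compat_r (y - x)) in Hq; [| lra].
  unfold Rdiv in Hq; rewrite Rmult_assoc, Rinv_l in Hq; lra.
- specialize (Hq y ltac:(lra)); rewrite Rabs_left in Hq by lra.
  specialize (Hq ltac:(lra)).
  apply (Rmult_lt_compat_r (x - y)) in Hq; [| lra].
  replace ((f y - f x) / (y - x) * (x - y)) with (f x - f y) in Hq by (field; lra); lra.
Qed.

(* At a zero f can only cross upwards, whereas after the last point of [a, b]
   where f >= 0 it would have to be negative. *)
Lemma crossing_pos (f df : R -> R) (a b : R) :
  (forall x, a <= x -> is_derive f x (df x)) ->
  (forall x, a <= x -> f x = 0 -> 0 < df x) ->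
  0 <= f a -> a < b -> 0 < f b.
Proof.
intros Hd Hz Ha Hab.
apply Rnot_le_lt; intros Hb.
(* If [f b = 0], then [f] increases through [b] and is negative just before it, so a strictly
   negative value may be assumed. *)
assert (Hb' : exists b', a < b' /\ f b' < 0).
{ destruct Hb as [Hb | Hb]; [now exists b |].
  destruct (is_derive_pos_locally f b (df b)) as [d [Hd0 [_ Hl]]];
    [apply Hd; lra | apply Hz; lra |].
  pose proof (Rmax_l a (b - d)); pose proof (Rmax_r a (b - d)).
  assert (Rmax a (b - d) < b) by (apply Rmax_lub_lt; lra).
  exists ((Rmax a (b - d) + b) / 2); split; [lra |].
  rewrite <- Hb; apply Hl; lra. }
clear b Hab Hb; destruct Hb' as [b [Hab Hb]].
(* [s] is the last point where [f] is nonnegative. If [f s < 0], continuity lowers the supremum; if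
   [f s >= 0], then [f] is still positive just after [s]. *)
destruct (completeness (fun x => a <= x <= b /\ 0 <= f x)) as [s [Hub Hlub]].
{ exists b; intros x [Hx _]; lra. }
{ exists a; split; lra. }
assert (Has : a <= s) by (apply Hub; split; lra).
assert (Hsb : s <= b) by (apply Hlub; intros x [Hx _]; lra).
assert (Hcont : continuous f s) by (apply (is_derive_continuous f s (df s)), Hd, Has).
destruct (Rtotal_order (f s) 0) as [Hs | [Hs | Hs]].
- assert (Hloc : locally s (fun x => f x < 0))
    by (apply (Hcont (fun z => z < 0)); now apply (open_lt 0)).
  destruct Hloc as [d Hloc]; pose proof (cond_pos d).
  assert (s <= s - d / 2); [| lra].
  apply Hlub; intros x [Hx Hfx].
  apply Rnot_lt_le; intros Hlt.
  assert (x <= s) by (apply Hub; split; lra).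
  specialize (Hloc x); cut (f x < 0); [lra | apply Hloc].
  apply Rabs_lt_between; unfold minus, plus, opp; simpl; lra.
- destruct (is_derive_pos_locally f s (df s)) as [d [Hd0 [Hr _]]];
    [now apply Hd | now apply Hz |].
  assert (Hsb' : s < b).
  { destruct Hsb as [| ->]; [easy | lra]. }
  pose proof (Rmin_l b (s + d)); pose proof (Rmin_r b (s + d)).
  assert (s < Rmin b (s + d)) by (apply Rmin_glb_lt; lra).
  set (y := (s + Rmin b (s + d)) / 2).
  specialize (Hr y ltac:(unfold y; lra)).
  assert (y <= s); [apply Hub; unfold y in *; split; lra | unfold y in *; lra].
- assert (Hsb' : s < b).
  { destruct Hsb as [| ->]; [easy | lra]. }
  assert (Hloc : locally s (fun x => 0 < f x))
    by (apply (Hcont (fun z => 0 < z)); now apply (open_gt 0)).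
  destruct Hloc as [d Hloc]; pose proof (cond_pos d).
  pose proof (Rmin_l b (s + d)); pose proof (Rmin_r b (s + d)).
  assert (s < Rmin b (s + d)) by (apply Rmin_glb_lt; lra).
  set (y := (s + Rmin b (s + d)) / 2).
  assert (0 < f y).
  { apply Hloc, Rabs_lt_between; unfold minus, plus, opp; simpl; unfold y; lra. }
  assert (y <= s); [apply Hub; unfold y in *; split; lra | unfold y in *; lra].
Qed.

Lemma derive_ge_increment (f df : R -> R) (a b m : R) :
  a <= b ->
  (forall x, a <= x <= b -> is_derive f x (df x)) ->
  (forall x, a <= x <= b -> m <= df x) ->
  f a + m * (b - a) <= f b.
Proof.
intros Hab Hd Hm.
destruct (MVT_gen f a b df) as [c [Hc He]].
- intros x Hx; rewrite Rmin_left, Rmax_right in Hx by lra; apply Hd; lra.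
- intros x Hx; rewrite Rmin_left, Rmax_right in Hx by lra.
  apply continuity_pt_filterlim, (is_derive_continuous f x (df x)), Hd; lra.
- rewrite Rmin_left, Rmax_right in Hc by lra.
  specialize (Hm c Hc).
  assert (m * (b - a) <= df c * (b - a)) by (apply Rmult_le_compat_r; lra).
  lra.
Qed.

(** Over a length (2 M + 1) / m the function gains at least 2 M + 1, more than the interval [- M, M]
    allows. *)
Lemma derive_ge_unbounded (f df : R -> R) (a m M : R) :
  0 < m ->
  (forall x, a <= x -> is_derive f x (df x)) ->
  (forall x, a <= x -> m <= df x) ->
  (forall x, a <= x -> Rabs (f x) <= M) -> False.
Proof.
intros Hm Hd Hdf HM.
assert (HM0 : 0 <= M).
{ specialize (HM a (Rle_refl a)); pose proof (Rabs_pos (f a)); lra. }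
set (T := (2 * M + 1) / m).
assert (HT : 0 < T) by (apply Rdiv_lt_0_compat; lra).
assert (HmT : m * T = 2 * M + 1) by (unfold T; field; lra).
pose proof (derive_ge_increment f df a (a + T) m ltac:(lra)) as H.
specialize (H ltac:(intros; apply Hd; lra) ltac:(intros; apply Hdf; lra)).
replace (a + T - a) with T in H by ring.
pose proof (HM a ltac:(lra)) as H1; apply Rabs_le_between in H1.
pose proof (HM (a + T) ltac:(lra)) as H2; apply Rabs_le_between in H2.
lra.
Qed.

(** Common form of the cases v < 1/2 and v > 1/2, which differ in the sign of [e]. [riccati_neg]
    keeps the quadratic term from outweighing the linear one while u <= 0. *)
Record bounded_riccati (k e M : R) (u du : R -> R) : Prop := {
  riccati_k : 0 < k;
  riccati_derive : forall x, 0 < x -> is_derive u x (du x);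
  riccati_eq : forall x, 0 < x ->
    x * du x = - k + u x + e * u x ^ 2 + 2 * x * u x;
  riccati_bound : forall x, 0 < x -> Rabs (u x) <= M;
  riccati_neg : forall x, 0 < x -> u x <= 0 -> u x + e * u x ^ 2 <= 0
}.

(** At a zero of u the equation gives x u' = - k < 0, so a nonpositive u becomes and stays negative.
    Then u' <= 2 u, so u decreases at a rate bounded away from 0 and cannot be bounded. *)
Lemma bounded_riccati_pos k e M u du x :
  bounded_riccati k e M u du -> 0 < x -> 0 < u x.
Proof.
intros [Hk Hd Heq HM Hneg] Hx.
apply Rnot_le_lt; intros Hux.
assert (Hopp : forall y, x <= y -> is_derive (fun y => - u y) y (- du y)).
{ intros y Hy; apply (is_derive_opp u), Hd; lra. }
assert (Hlt : forall y, x < y -> u y < 0).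
{ intros y Hy.
  cut (0 < - u y); [lra |].
  apply (crossing_pos (fun y => - u y) (fun y => - du y) x y); auto; [| lra].
  intros z Hz H0.
  assert (Hu0 : u z = 0) by lra.
  specialize (Heq z ltac:(lra)); rewrite Hu0 in Heq.
  assert (z * du z < 0) by lra.
  nra. }
(* The start moves to [x + 1] because [u x] may be 0, while [u (x + 1)] is strictly negative. *)
assert (Hdu : forall y, x + 1 <= y -> du y <= 2 * u y).
{ intros y Hy.
  specialize (Heq y ltac:(lra)).
  specialize (Hneg y ltac:(lra) ltac:(left; apply Hlt; lra)).
  apply (Rmult_le_reg_l y); lra. }
assert (Hmon : forall y, x + 1 <= y -> u y <= u (x + 1)).
{ intros y Hy.
  pose proof (derive_ge_increment (fun y => - u y) (fun y => - du y) (x + 1) y 0 Hy) as H.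
  specialize (H ltac:(intros; apply Hopp; lra)).
  assert (- u (x + 1) + 0 * (y - (x + 1)) <= - u y); [apply H | lra].
  intros z Hz; specialize (Hdu z ltac:(lra)); specialize (Hlt z ltac:(lra)); lra. }
apply (derive_ge_unbounded (fun y => - u y) (fun y => - du y) (x + 1) (- (2 * u (x + 1))) M).
- specialize (Hlt (x + 1) ltac:(lra)); lra.
- intros y Hy; apply Hopp; lra.
- intros y Hy; specialize (Hdu y Hy); specialize (Hmon y Hy); lra.
- intros y Hy; rewrite Rabs_Ropp; apply HM; lra.
Qed.

(** If u >= c, then 2 x u >= 2 c x. Beyond [B] one half of this pays for k + |e| M^2, and the other
    half gives u' >= c. *)
Lemma bounded_riccati_not_ge k e M u du a c :
  bounded_riccati k e M u du -> 0 < a -> 0 < c ->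
  ~ (forall x, a <= x -> c <= u x).
Proof.
intros [Hk Hd Heq HM Hneg] Ha Hc Hu.
set (B := (k + Rabs e * M ^ 2) / c).
pose proof (Rmax_l a B) as Hl; pose proof (Rmax_r a B) as Hr.
apply (derive_ge_unbounded u du (Rmax a B) c M); try easy.
- intros x Hx; apply Hd; lra.
- intros x Hx.
  specialize (Heq x ltac:(lra)); specialize (Hu x ltac:(lra)).
  specialize (HM x ltac:(lra)).
  assert (He : - (Rabs e * M ^ 2) <= e * u x ^ 2).
  { assert (Rabs (e * u x ^ 2) <= Rabs e * M ^ 2).
    { rewrite Rabs_mult, <- RPow_abs.
      apply Rmult_le_compat_l; [apply Rabs_pos |].
      apply pow_incr; split; [apply Rabs_pos | easy]. }
    apply Rabs_le_between in H; lra. }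
  assert (HB : k + Rabs e * M ^ 2 <= c * x).
  { replace (k + Rabs e * M ^ 2) with (c * B) by (unfold B; field; lra).
    apply Rmult_le_compat_l; lra. }
  apply (Rmult_le_reg_l x); [lra |].
  assert (x * c <= x * u x) by (apply Rmult_le_compat_l; lra).
  lra.
- intros x Hx; apply HM; lra.
Qed.

(** Let F = x u'. Where F vanishes, u' = 0 and F' = 2 u > 0, so from u' >= 0 at one point F is
    positive ever after. Then u never drops below its positive value there, which is excluded. *)
Lemma bounded_riccati_deriv_neg k e M u du x :
  bounded_riccati k e M u du -> 0 < x -> du x < 0.
Proof.
intros HR Hx.
pose proof (bounded_riccati_pos k e M u du) as Hpos.
apply Rnot_le_lt; intros Hdu.
pose proof HR as [Hk Hd Heq HM Hneg].
set (F := fun y => - k + u y + e * u y ^ 2 + 2 * y * u y).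
set (dF := fun y => du y * (1 + 2 * e * u y + 2 * y) + 2 * u y).
assert (HF : forall y, x < y -> 0 < F y).
{ intros y Hy; apply (crossing_pos F dF x y); [| | | easy].
  - intros z Hz; unfold F, dF.
    assert (Hex : is_derive u z (du z)) by (apply Hd; lra).
    auto_derive; [repeat split; now exists (du z) |].
    replace (Derive (fun y => u y) z) with (du z)
      by (symmetry; apply is_derive_unique, Hex).
    ring.
  - intros z Hz H0; unfold F in H0; unfold dF.
    rewrite <- Heq in H0 by lra.
    assert (du z = 0) by (apply Rmult_integral in H0; destruct H0; lra).
    rewrite H; specialize (Hpos z HR ltac:(lra)); lra.
  - unfold F; rewrite <- Heq by easy; apply Rmult_le_pos; lra. }
apply (bounded_riccati_not_ge k e M u du x (u x) HR Hx (Hpos x HR Hx)).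
intros y Hy.
pose proof (derive_ge_increment u du x y 0 Hy) as H.
cut (u x + 0 * (y - x) <= u y); [lra | apply H].
- intros; apply Hd; lra.
- intros z Hz.
  destruct (proj1 Hz) as [Hlt | <-]; [| easy].
  specialize (HF z Hlt); unfold F in HF; rewrite <- Heq in HF by lra.
  apply (Rmult_le_reg_l z); lra.
Qed.

Lemma bounded_riccati_decr k e M u du x y :
  bounded_riccati k e M u du -> 0 < x -> x < y -> u y < u x.
Proof.
intros HR Hx Hxy.
destruct (MVT_gen u x y du) as [c [Hc He]].
- intros z Hz; rewrite Rmin_left, Rmax_right in Hz by lra.
  apply (riccati_derive _ _ _ _ _ HR); lra.
- intros z Hz; rewrite Rmin_left, Rmax_right in Hz by lra.
  apply continuity_pt_filterlim, (is_derive_continuous u z (du z)).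
  apply (riccati_derive _ _ _ _ _ HR); lra.
- rewrite Rmin_left, Rmax_right in Hc by lra.
  pose proof (bounded_riccati_deriv_neg k e M u du c HR ltac:(lra)).
  nra.
Qed.

(* Near 0 the equation reads x u' = q(u) + O(x) with q(u) < 0, so u would grow
   like - ln x; the substitution x = x0 exp(-s) makes this a linear growth in s. *)
Lemma bounded_riccati_exceeds k e M u du y d :
  bounded_riccati k e M u du -> 0 < d ->
  (forall x, 0 < x -> u x <= y -> - k + u x + e * u x ^ 2 <= - d) ->
  exists x, 0 < x /\ y < u x.
Proof.
intros HR Hd Hq.
destruct (Classical_Prop.classic (exists x, 0 < x /\ y < u x)) as [| Hn]; [easy | exfalso].
assert (Hle : forall x, 0 < x -> u x <= y).
{ intros x Hx; apply Rnot_lt_le; intros H; apply Hn; now exists x. }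
destruct HR as [Hk Hder Heq HM _].
assert (HM0 : 0 <= M).
{ specialize (HM 1 ltac:(lra)); pose proof (Rabs_pos (u 1)); lra. }
(* Chosen so that 2 x u <= d / 2 for x <= x0; hence x u' <= - d / 2, and the derivative in s is at
   least d / 2. *)
set (x0 := d / (4 * (M + 1))).
assert (Hx0 : 0 < x0) by (apply Rdiv_lt_0_compat; lra).
assert (Hpos : forall s, 0 < x0 * exp (- s)).
{ intros s; apply Rmult_lt_0_compat; [easy | apply exp_pos]. }
apply (derive_ge_unbounded (fun s => u (x0 * exp (- s)))
  (fun s => - (x0 * exp (- s)) * du (x0 * exp (- s))) 0 (d / 2) M).
- lra.
- intros s Hs.
  apply (is_derive_comp u (fun s => x0 * exp (- s)) s).
  + apply Hder, Hpos.
  + auto_derive; [easy | ring].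
- intros s Hs; specialize (Hpos s).
  assert (Hx : x0 * exp (- s) <= x0).
  { assert (exp (- s) <= 1) by (rewrite <- exp_0; apply exp_le_compat; lra). nra. }
  set (x := x0 * exp (- s)) in *.
  specialize (Heq x Hpos); specialize (Hq x Hpos (Hle x Hpos)).
  specialize (HM x Hpos); apply Rabs_le_between in HM.
  assert (HxM : x * u x <= d / 4).
  { apply Rle_trans with (x0 * (M + 1)); [nra |].
    unfold x0; right; field; lra. }
  lra.
- intros s Hs; apply HM, Hpos.
Qed.

(** The gap [d] forces u above y somewhere, and u cannot stay above a positive constant forever; the
    intermediate value theorem does the rest. *)
Lemma bounded_riccati_onto k e M u du y d :
  bounded_riccati k e M u du -> 0 < y -> 0 < d ->
  (forall x, 0 < x -> u x <= y -> - k + u x + e * u x ^ 2 <= - d) ->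
  exists x, 0 < x /\ u x = y.
Proof.
intros HR Hy Hd Hq.
destruct (bounded_riccati_exceeds k e M u du y d HR Hd Hq) as [x1 [Hx1 H1]].
assert (H2 : exists x2, x1 <= x2 /\ u x2 < y).
{ destruct (Classical_Prop.classic (exists x2, x1 <= x2 /\ u x2 < y)) as [| Hn]; [easy | exfalso].
  apply (bounded_riccati_not_ge k e M u du x1 y HR Hx1 Hy).
  intros x Hx; apply Rnot_lt_le; intros H; apply Hn; now exists x. }
destruct H2 as [x2 [H12 H2]].
assert (Hlt : x1 < x2) by (destruct H12 as [| <-]; lra).
destruct (Ranalysis5.IVT_interv (fun x => y - u x) x1 x2) as [x [Hx Hux]]; try lra.
- intros x Hx; apply continuity_pt_filterlim.
  apply (continuous_minus (fun _ => y) u); [apply continuous_const |].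
  apply (is_derive_continuous u x (du x)), (riccati_derive _ _ _ _ _ HR); lra.
- exists x; lra.
Qed.

(** * The Riccati equation of Lambda *)

Lemma besselK_gt_0 v x : 0 < x -> 0 < besselK v x.
Proof.
intros Hx; apply (cosh_laplace_gt_0 (fun t => cosh (v * t))); auto using exp_growth_cosh.
intros t _; pose proof (cosh_ge_1 (v * t)); lra.
Qed.

Definition besselK' (v x : R) : R := - cosh_laplace (fun t => cosh t * cosh (v * t)) x.

Definition besselK'' (v x : R) : R :=
  cosh_laplace (fun t => cosh t * (cosh t * cosh (v * t))) x.

Lemma is_derive_besselK v x : 0 < x -> is_derive (besselK v) x (besselK' v x).
Proof. apply (is_derive_cosh_laplace (fun t => cosh (v * t))), exp_growth_cosh. Qed.

Lemma is_derive_besselK' v x : 0 < x -> is_derive (besselK' v) x (besselK'' v x).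
Proof.
intros Hx.
assert (Hc : exp_growth (fun t => cosh t * cosh (v * t)))
  by (apply exp_growth_mult; auto using exp_growth_cosh1, exp_growth_cosh).
pose proof (is_derive_opp _ _ _ (is_derive_cosh_laplace _ x Hc Hx)) as H.
unfold opp in H; simpl in H; rewrite Ropp_involutive in H; exact H.
Qed.

(* Two integrations by parts, starting from cosh^2 = 1 + sinh^2. *)
Lemma besselK_ode v x :
  0 < x ->
  x ^ 2 * besselK'' v x + x * besselK' v x = (x ^ 2 + v ^ 2) * besselK v x.
Proof.
intros Hx.
pose proof (exp_growth_cosh v) as Hc; pose proof (exp_growth_sinh v) as Hs.
pose proof exp_growth_cosh1 as Hc1; pose proof exp_growth_sinh1 as Hs1.
assert (H1 : besselK'' v x
  = besselK v x + cosh_laplace (fun t => sinh t * (sinh t * cosh (v * t))) x).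
{ unfold besselK''; change (besselK v x) with (cosh_laplace (fun t => cosh (v * t)) x).
  rewrite <- (cosh_laplace_plus (fun t => cosh (v * t))) by auto using exp_growth_mult.
  apply cosh_laplace_ext; [| auto using exp_growth_mult | easy].
  intros t; pose proof (cosh2_sinh2 t) as H.
  rewrite <- !Rmult_assoc.
  replace (cosh t * cosh t) with (1 + sinh t * sinh t) by lra; ring. }
assert (H2 : x * cosh_laplace (fun t => sinh t * (sinh t * cosh (v * t))) x
  = - besselK' v x + v * cosh_laplace (fun t => sinh t * sinh (v * t)) x).
{ rewrite (cosh_laplace_by_parts (fun t => sinh t * cosh (v * t))
    (fun t => cosh t * cosh (v * t) + v * (sinh t * sinh (v * t))));
    auto using exp_growth_mult, exp_growth_plus, exp_growth_scal.
  - rewrite cosh_laplace_plus, cosh_laplace_scal by auto using exp_growth_mult, exp_growth_scal.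
    rewrite sinh_0; unfold besselK'; ring.
  - intros t.
    evar_last.
    { apply (is_derive_mult sinh (fun t => cosh (v * t)) t (cosh t) (v * sinh (v * t))).
      - apply is_derive_sinh.
      - apply is_derive_cosh_scal.
      - intros; apply Rmult_comm. }
    unfold plus, mult; simpl; unfold mult; simpl; ring. }
assert (H3 : x * cosh_laplace (fun t => sinh t * sinh (v * t)) x = v * besselK v x).
{ rewrite (cosh_laplace_by_parts (fun t => sinh (v * t)) (fun t => v * cosh (v * t)));
    auto using exp_growth_scal, is_derive_sinh_scal.
  rewrite cosh_laplace_scal, Rmult_0_r, sinh_0 by easy; unfold besselK, cosh_laplace; ring. }
rewrite H1.
replace (x ^ 2 * (besselK v x + cosh_laplace (fun t => sinh t * (sinh t * cosh (v * t))) x))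
  with (x ^ 2 * besselK v x
        + x * (x * cosh_laplace (fun t => sinh t * (sinh t * cosh (v * t))) x)) by ring.
rewrite H2.
replace (x * (- besselK' v x + v * cosh_laplace (fun t => sinh t * sinh (v * t)) x))
  with (- x * besselK' v x + v * (x * cosh_laplace (fun t => sinh t * sinh (v * t)) x)) by ring.
rewrite H3; ring.
Qed.

Lemma Lambda_eq v x : 0 < x -> Lambda v x = x + x * besselK' v x / besselK v x.
Proof.
intros Hx; unfold Lambda.
now rewrite (is_derive_unique _ _ _ (is_derive_besselK v x Hx)).
Qed.

(** For w = x K' / K the Bessel equation reads x w' = x^2 + v^2 - w^2; then put w = Lambda - x. *)
Lemma is_derive_Lambda v x :
  0 < x ->
  is_derive (Lambda v) x
    ((v ^ 2 - Lambda v x ^ 2 + x * (1 + 2 * Lambda v x)) / x).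
Proof.
intros Hx.
apply (is_derive_ext_loc (fun y => y + y * besselK' v y / besselK v y)).
{ exists (mkposreal x Hx); intros y Hy; symmetry; apply Lambda_eq.
  apply Rabs_lt_between in Hy; unfold minus, plus, opp in Hy; simpl in Hy; lra. }
pose proof (besselK_gt_0 v x Hx) as HK.
pose proof (is_derive_besselK v x Hx) as H1.
pose proof (is_derive_besselK' v x Hx) as H2.
pose proof (besselK_ode v x Hx) as Hode.
auto_derive.
{ repeat split; [now exists (besselK'' v x) | now exists (besselK' v x) | lra]. }
replace (Derive (fun y => besselK v y) x) with (besselK' v x)
  by (symmetry; apply is_derive_unique, H1).
replace (Derive (fun y => besselK' v y) x) with (besselK'' v x)
  by (symmetry; apply is_derive_unique, H2).
rewrite Lambda_eq by easy.
assert (H : besselK'' v x = ((x ^ 2 + v ^ 2) * besselK v x - x * besselK' v x) / x ^ 2).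
{ rewrite <- Hode; field; lra. }
rewrite H; field; lra.
Qed.

(** * A priori bounds for Lambda *)

Lemma Lambda_lt_0 v x : 0 < x -> Lambda v x < 0.
Proof.
intros Hx; rewrite Lambda_eq by easy.
pose proof (besselK_gt_0 v x Hx) as HK.
(* The weights compare pointwise because cosh t > 1 for t > 0. *)
assert (H : besselK v x < - besselK' v x).
{ unfold besselK'; rewrite Ropp_involutive.
  apply (cosh_laplace_lt (fun t => cosh (v * t)) (fun t => cosh t * cosh (v * t)));
    auto using exp_growth_mult, exp_growth_cosh, exp_growth_cosh1.
  intros t Ht; pose proof (cosh_gt_1 t Ht); pose proof (cosh_ge_1 (v * t)); nra. }
apply (Rmult_lt_reg_r (besselK v x)); [easy |].
replace ((x + x * besselK' v x / besselK v x) * besselK v x)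
  with (x * (besselK v x + besselK' v x)) by (field; lra).
nra.
Qed.

Lemma Rabs_sinh_lt_cosh t : Rabs (sinh t) < cosh t.
Proof.
pose proof (exp_pos t); pose proof (exp_pos (- t)).
apply Rabs_lt_between; unfold sinh, cosh; lra.
Qed.

(* With g = tanh (t / 2) = sinh t / (1 + cosh t) one has cosh t - 1 = sinh t * g,
   so integrating by parts absorbs the factor x. *)
Lemma Lambda_gt v x : 0 <= v -> 0 < x -> - (1 + v) < Lambda v x.
Proof.
intros Hv Hx; rewrite Lambda_eq by easy.
pose proof (besselK_gt_0 v x Hx) as HK.
pose proof (exp_growth_cosh v) as Hc; pose proof (exp_growth_sinh v) as Hs.
pose proof exp_growth_cosh1 as Hc1.
set (g := fun t => sinh t / (1 + cosh t)).
set (g' := fun t => / (1 + cosh t)).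
assert (Hpos : forall t, 0 < / (1 + cosh t) < 1).
{ intros t; pose proof (cosh_ge_1 t); split.
  - apply Rinv_0_lt_compat; lra.
  - rewrite <- Rinv_1; apply Rinv_lt_contravar; lra. }
assert (Hg : forall t, is_derive g t (g' t)).
{ intros t; pose proof (cosh_ge_1 t).
  evar_last.
  { apply (is_derive_div sinh (fun t => 1 + cosh t) t (cosh t) (sinh t)).
    - apply is_derive_sinh.
    - auto_derive; [easy | ring].
    - lra. }
  unfold g'; pose proof (cosh2_sinh2 t) as H2.
  replace (cosh t * (1 + cosh t) - sinh t * sinh t) with (1 + cosh t) by lra.
  field; lra. }
assert (Hg1 : forall t, Rabs (g t) < 1).
{ intros t; unfold g; pose proof (cosh_ge_1 t); pose proof (Rabs_sinh_lt_cosh t).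
  rewrite Rabs_div, (Rabs_pos_eq (1 + cosh t)) by lra.
  apply (Rmult_lt_reg_r (1 + cosh t)); [lra |].
  unfold Rdiv; rewrite Rmult_assoc, Rinv_l; lra. }
assert (Hag : exp_growth g).
{ apply (exp_growth_of_bounded g 1).
  - intros t; apply (is_derive_continuous g t (g' t)), Hg.
  - intros t; left; apply Hg1. }
assert (Hag' : exp_growth g').
{ apply (exp_growth_of_bounded g' 1).
  - intros t; pose proof (cosh_ge_1 t).
    apply (ex_derive_continuous g'); unfold g'; auto_derive; repeat split; lra.
  - intros t; unfold g'; specialize (Hpos t); rewrite Rabs_pos_eq; lra. }
assert (Had : exp_growth (fun t => g' t * cosh (v * t) + v * (g t * sinh (v * t))))
  by auto using exp_growth_plus, exp_growth_mult, exp_growth_scal.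
assert (H1 : x * cosh_laplace (fun t => sinh t * (g t * cosh (v * t))) x
  = cosh_laplace (fun t => g' t * cosh (v * t) + v * (g t * sinh (v * t))) x).
{ rewrite (cosh_laplace_by_parts (fun t => g t * cosh (v * t))
    (fun t => g' t * cosh (v * t) + v * (g t * sinh (v * t))));
    auto using exp_growth_mult.
  - unfold g at 1; rewrite sinh_0; unfold Rdiv; ring.
  - intros t.
    evar_last.
    { apply (is_derive_mult g (fun t => cosh (v * t)) t (g' t) (v * sinh (v * t))).
      - apply Hg.
      - apply is_derive_cosh_scal.
      - intros; apply Rmult_comm. }
    unfold plus, mult; simpl; unfold mult; simpl; ring. }
assert (H2 : cosh_laplace (fun t => sinh t * (g t * cosh (v * t))) x
  = - besselK' v x + -1 * besselK v x).
{ unfold besselK'; rewrite Ropp_involutive.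
  change (besselK v x) with (cosh_laplace (fun t => cosh (v * t)) x).
  rewrite <- cosh_laplace_scal by easy.
  rewrite <- cosh_laplace_plus by auto using exp_growth_mult, exp_growth_scal.
  symmetry; apply cosh_laplace_ext;
    [| auto using exp_growth_plus, exp_growth_mult, exp_growth_scal | easy].
  intros t; unfold g; pose proof (cosh_ge_1 t); pose proof (cosh2_sinh2 t).
  replace (sinh t * (sinh t / (1 + cosh t) * cosh (v * t)))
    with ((sinh t * sinh t) * cosh (v * t) / (1 + cosh t)) by (field; lra).
  replace (sinh t * sinh t) with (cosh t * cosh t - 1) by lra.
  field; lra. }
assert (H3 : cosh_laplace (fun t => g' t * cosh (v * t) + v * (g t * sinh (v * t))) x
  < (1 + v) * besselK v x).
(* Pointwise, g' < 1, |g| < 1 and |sinh (v t)| < cosh (v t). *)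
{ change (besselK v x) with (cosh_laplace (fun t => cosh (v * t)) x).
  rewrite <- cosh_laplace_scal by easy.
  apply cosh_laplace_lt; auto using exp_growth_scal.
  intros t _; specialize (Hg1 t); specialize (Hpos t); fold (g' t) in Hpos.
  pose proof (Rabs_sinh_lt_cosh (v * t)).
  assert (g t * sinh (v * t) <= cosh (v * t)).
  { apply Rle_trans with (1 := Rle_abs _); rewrite Rabs_mult.
    pose proof (Rabs_pos (g t)); pose proof (Rabs_pos (sinh (v * t))); nra. }
  pose proof (cosh_ge_1 (v * t)); nra. }
rewrite H2 in H1; rewrite <- H1 in H3.
apply (Rmult_lt_reg_r (besselK v x)); [easy |].
replace ((x + x * besselK' v x / besselK v x) * besselK v x)
  with (x * (besselK v x + besselK' v x)) by (field; lra).
lra.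
Qed.

(** Substituting Lambda = (s u - 1) / 2 with s^2 = 1 gives 2 s (v^2 - Lambda^2) = - k + u - (s / 2)
    u^2. The bound [M] comes from - (1 + v) < Lambda < 0. For s = - 1, Lambda < 0 means u > - 1,
    which gives [riccati_neg]. *)
Lemma bounded_riccati_Lambda v s :
  0 <= v -> s = 1 \/ s = - 1 -> 0 < s * (1 / 2 - 2 * v ^ 2) ->
  bounded_riccati (s * (1 / 2 - 2 * v ^ 2)) (- s / 2) (3 + 2 * v)
    (fun x => s * (1 + 2 * Lambda v x))
    (fun x => s * (2 * ((v ^ 2 - Lambda v x ^ 2 + x * (1 + 2 * Lambda v x)) / x))).
Proof.
intros Hv Hs Hk; split; [easy | | | |]; intros x Hx.
- pose proof (is_derive_Lambda v x Hx) as H.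
  auto_derive; [repeat split; eexists; exact H |].
  replace (Derive (fun y => Lambda v y) x)
    with ((v ^ 2 - Lambda v x ^ 2 + x * (1 + 2 * Lambda v x)) / x)
    by (symmetry; apply is_derive_unique, H).
  ring.
- destruct Hs as [-> | ->]; field; lra.
- pose proof (Lambda_lt_0 v x Hx); pose proof (Lambda_gt v x Hv Hx).
  destruct Hs as [-> | ->]; apply Rabs_le_between; lra.
- pose proof (Lambda_lt_0 v x Hx).
  destruct Hs as [-> | ->]; nra.
Qed.

(** * Monotonicity, range and best constants *)

Lemma Lambda_gt_half v :
  1 / 2 < v ->
  strictly_increasing_pos (Lambda v) /\ pos_onto (Lambda v) (- v) (- (1 / 2)).
Proof.
intros Hv.
assert (HR := bounded_riccati_Lambda v (- 1) ltac:(lra) ltac:(now right) ltac:(nra)).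
split; [| split].
- intros x y Hx Hxy; pose proof (bounded_riccati_decr _ _ _ _ _ x y HR Hx Hxy); simpl in *; lra.
- intros x Hx.
  pose proof (bounded_riccati_pos _ _ _ _ _ x HR Hx) as Hpos.
  pose proof (bounded_riccati_deriv_neg _ _ _ _ _ x HR Hx) as Hneg.
  pose proof (Lambda_lt_0 v x Hx).
  simpl in *; split; [| lra].
  (* Lambda' > 0 and 1 + 2 Lambda < 0 force Lambda^2 < v^2, the bound at the end x = 0. *)
  assert (H1 : 0 < (v ^ 2 - Lambda v x ^ 2 + x * (1 + 2 * Lambda v x)) / x) by lra.
  apply (Rmult_lt_compat_r x) in H1; [| easy].
  unfold Rdiv in H1; rewrite Rmult_assoc, Rinv_l, Rmult_1_r in H1 by lra.
  nra.
- intros y Hy.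
  (* The quadratic in u equals 2 (Lambda^2 - v^2). While u is at most its target, y <= Lambda < -
     1/2, so Lambda^2 <= y^2. *)
  destruct (bounded_riccati_onto _ _ _ _ _ (- (1 + 2 * y)) (2 * (v ^ 2 - y ^ 2)) HR)
    as [x [Hx Hux]]; [lra | nra | |].
  + intros x Hx Hle.
    pose proof (bounded_riccati_pos _ _ _ _ _ x HR Hx); simpl in *; nra.
  + exists x; split; [easy | lra].
Qed.

Lemma Lambda_lt_half v :
  0 <= v -> v < 1 / 2 ->
  strictly_decreasing_pos (Lambda v) /\ pos_onto (Lambda v) (- (1 / 2)) (- v).
Proof.
intros Hv0 Hv.
assert (HR := bounded_riccati_Lambda v 1 Hv0 ltac:(now left) ltac:(nra)).
split; [| split].
- intros x y Hx Hxy; pose proof (bounded_riccati_decr _ _ _ _ _ x y HR Hx Hxy); simpl in *; lra.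
- intros x Hx.
  pose proof (bounded_riccati_pos _ _ _ _ _ x HR Hx) as Hpos.
  pose proof (bounded_riccati_deriv_neg _ _ _ _ _ x HR Hx) as Hneg.
  pose proof (Lambda_lt_0 v x Hx).
  simpl in *; split; [lra |].
  (* Here Lambda' < 0 and 1 + 2 Lambda > 0 give Lambda^2 > v^2, and Lambda is negative. *)
  assert (H1 : (v ^ 2 - Lambda v x ^ 2 + x * (1 + 2 * Lambda v x)) / x < 0) by lra.
  apply (Rmult_lt_compat_r x) in H1; [| easy].
  unfold Rdiv in H1; rewrite Rmult_assoc, Rinv_l, Rmult_1_r in H1 by lra.
  nra.
- intros y Hy.
  destruct (bounded_riccati_onto _ _ _ _ _ (1 + 2 * y) (2 * (y ^ 2 - v ^ 2)) HR)
    as [x [Hx Hux]]; [lra | nra | |].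
  + intros x Hx Hle.
    pose proof (Lambda_lt_0 v x Hx); simpl in *; nra.
  + exists x; split; [easy | lra].
Qed.

(** Lambda takes every value in (a, b), so no constant can improve on an endpoint. *)
Lemma pos_onto_sharp v a b :
  a < b -> pos_onto (Lambda v) a b ->
  (forall x, 0 < x ->
    - x + a < x * Derive (besselK v) x / besselK v x < - x + b) /\
  (forall p,
    (forall x, 0 < x -> x * Derive (besselK v) x / besselK v x < - x - p) ->
    p <= - b) /\
  (forall q,
    (forall x, 0 < x -> - x - q < x * Derive (besselK v) x / besselK v x) ->
    - a <= q).
Proof.
intros Hab [Hin Hon]; unfold Lambda in *; split; [| split].
- intros x Hx; specialize (Hin x Hx); lra.
- intros p Hp; apply Rnot_lt_le; intros Hlt.
  pose proof (Rmax_l a (- p)); pose proof (Rmax_r a (- p)).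
  assert (Rmax a (- p) < b) by (apply Rmax_lub_lt; lra).
  (* The midpoint lies in (a, b) and above - p, so attaining it violates the bound by [p]. *)
  destruct (Hon ((Rmax a (- p) + b) / 2) ltac:(lra)) as [x [Hx He]].
  specialize (Hp x Hx); lra.
- intros q Hq; apply Rnot_lt_le; intros Hlt.
  pose proof (Rmin_l b (- q)); pose proof (Rmin_r b (- q)).
  assert (a < Rmin b (- q)) by (apply Rmin_glb_lt; lra).
  destruct (Hon ((a + Rmin b (- q)) / 2) ltac:(lra)) as [x [Hx He]].
  specialize (Hq x Hx); lra.
Qed.

Theorem proposition2 (v : R) (hv : 0 <= v) :
  (1 / 2 < v ->
     strictly_increasing_pos (Lambda v) /\
     pos_onto (Lambda v) (- v) (- (1 / 2))) /\
  (v < 1 / 2 ->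
     strictly_decreasing_pos (Lambda v) /\
     pos_onto (Lambda v) (- (1 / 2)) (- v)) /\
  (v <> 1 / 2 ->
     (forall x : R, 0 < x ->
        - x - Rmax v (1 / 2) < x * Derive (besselK v) x / besselK v x
          < - x - Rmin v (1 / 2)) /\
     (forall p : R,
        (forall x : R, 0 < x ->
           x * Derive (besselK v) x / besselK v x < - x - p) ->
        p <= Rmin v (1 / 2)) /\
     (forall q : R,
        (forall x : R, 0 < x ->
           - x - q < x * Derive (besselK v) x / besselK v x) ->
        Rmax v (1 / 2) <= q)).
Proof.
split; [exact (Lambda_gt_half v) | split; [exact (Lambda_lt_half v hv) |]].
intros Hne.
destruct (Rtotal_order v (1 / 2)) as [Hv | [Hv | Hv]]; [| easy |].
- rewrite Rmax_right, Rmin_left by lra.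
  destruct (pos_onto_sharp v (- (1 / 2)) (- v) ltac:(lra) (proj2 (Lambda_lt_half v hv Hv)))
    as [H1 [H2 H3]].
  rewrite Ropp_involutive in H2, H3; auto.
- rewrite Rmax_left, Rmin_right by lra.
  destruct (pos_onto_sharp v (- v) (- (1 / 2)) ltac:(lra) (proj2 (Lambda_gt_half v Hv)))
    as [H1 [H2 H3]].
  rewrite Ropp_involutive in H2, H3; auto.
Qed.
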